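(* For all integers $q$ and $n$ such that $q$ is nonnegative and $n-q$ is positive and even, there exists an optimal $F_q(n)$-polychromatic coloring of the edges of $K_n$ which is simply-ordered.
   Context: $K_n$ is the complete graph on $n$ vertices. $F_q(n)$ is the family of all matchings in $K_n$ spanning precisely $n-q$ vertices. For a set $\mathcal{H}$ of subgraphs of a graph $G$, an edge-coloring of $G$ is $\mathcal{H}$-polychromatic if every graph in $\mathcal{H}$ has all colors present in $G$ on its edges. $\mathrm{poly}_{\mathcal{H}}(G)$ is the largest number of colors in an $\mathcal{H}$-polychromatic coloring of $G$; an $\mathcal{H}$-polychromatic coloring using exactly $\mathrm{poly}_{\mathcal{H}}(G)$ colors is called optimal. An edge-coloring $\varphi$ of $K_n$ is ordered if there is an ordering $v_1,\dots,v_n$ of the vertices such that $\varphi(v_iv_j)=\varphi(v_iv_m)$ for all $1\le i<j<m\le n$. It is simply-ordered if moreover (for this ordering), for all $i<j<m$, $\varphi(v_iv_m)=\varphi(v_jv_m)=a$ implies $\varphi(v_tv_m)=a$ for all $i\le t\le j$. *)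

(* Defs.v *)
From mathcomp Require Import all_boot all_fingroup.

Set Implicit Arguments.
Unset Strict Implicit.
Unset Printing Implicit Defensive.

(* A graph on a finite vertex type T is represented by its set of edges, an
   edge being a two-element set of vertices.  Colors are natural numbers; an
   edge-coloring is a function on all of {set T}, but only its values on the
   edges of the graph under consideration are ever used. *)

Section Polychromatic.
Variable T : finType.
Implicit Types (G F : {set {set T}}) (H : {set {set {set T}}}).
Implicit Types (phi : {set T} -> nat).

Definition colors phi G : seq nat := undup [seq phi e | e in G].

Definition num_colors phi G : nat := size (colors phi G).

Definition polychromatic G H phi : Prop :=
  forall F, F \in H -> {subset colors phi G <= colors phi F}.

(* "k is the number poly_H(G)" *)
Definition is_poly G H (k : nat) : Prop :=
  (exists2 phi, polychromatic G H phi & num_colors phi G = k) /\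
  (forall phi, polychromatic G H phi -> num_colors phi G <= k).

Definition optimal G H phi : Prop :=
  polychromatic G H phi /\ is_poly G H (num_colors phi G).

Definition matching F : bool :=
  [forall e in F, #|e| == 2] && trivIset F.

End Polychromatic.

Definition complete_graph (n : nat) : {set {set 'I_n}} :=
  [set e : {set 'I_n} | #|e| == 2].

Definition matchings_missing (q n : nat) : {set {set {set 'I_n}}} :=
  [set M : {set {set 'I_n}} |
     [&& M \subset complete_graph n, matching M & #|cover M| == n - q]].

(* The ordering v_1, ..., v_n is the permutation v, indexed from 0. *)
Definition ordered_by (n : nat) (phi : {set 'I_n} -> nat) (v : 'S_n) : Prop :=
  forall i j m : 'I_n, i < j -> j < m ->
    phi [set v i; v j] = phi [set v i; v m].

Definition simply_ordered (n : nat) (phi : {set 'I_n} -> nat) : Prop :=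
  exists v : 'S_n, ordered_by phi v /\
    forall (i j m : 'I_n) (a : nat), i < j -> j < m ->
      phi [set v i; v m] = a -> phi [set v j; v m] = a ->
      forall t : 'I_n, i <= t -> t <= j -> phi [set v t; v m] = a.

(* Main.v *)
Require Import Defs.
From mathcomp Require Import all_boot all_fingroup zify.
Set Implicit Arguments.
Unset Strict Implicit.
Unset Printing Implicit Defensive.

(** Write B_t = (2 ^ t - 1) * q.+1.  The number poly of F_q(n) is the largest k
    with B_k <= n, and the coloring that attains it below is simply-ordered.

    Lower bound.  Cut the ordered vertices at the thresholds B_t and give an
    edge the index of the block of its smaller end (block_color), the last
    block absorbing whatever remains.  Block t has B_t + q + 1 vertices or more
    and is preceded by only B_t vertices.  A matching avoiding color t sends the
    block injectively into the preceding vertices, apart from the at most q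
    vertices that it misses, which is impossible (block_color_on_matching).

    Upper bound.  In a polychromatic coloring, the edges not colored i contain
    no matching on n - q vertices.  By the Tutte-Berge theorem (tutte_berge,
    proved through Gallai's lemma) there are a set S_i and a labelling c_i of
    the other vertices, with at least |S_i| + q + 2 labels, such that every edge
    between different labels has color i (polychromatic_barrier; the 2 instead
    of 1 is the parity of n - q).  For two colors with |S_i| <= |S_j|, the
    labelling c_i is constant outside S_i and S_j: otherwise c_j would be, and
    all but one of the labels of c_j would occur inside S_i, making S_i larger
    than S_j.  Moreover the exceptional label of c_i is the same for all such j
    (same_exceptional_label).  So at least |S_i| + q + 1 vertices outside S_i,
    the core of i, lie in every larger S_j (card_core).  Cores of distinct
    colors are disjoint and S_j contains the cores of the smaller S_i, so the
    size of each core exceeds by q + 1 or more the sum of the sizes of the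
    previous ones.  This doubling gives B_k <= n for k colors
    (barriers_bound). *)

(** * Matchings *)

Section Matchings.
Variable T : finType.
Implicit Types (M N E : {set {set T}}) (S W : {set T}) (x y z u v w : T).

Lemma matching_trivIset M : matching M -> trivIset M.
Proof. by case/andP. Qed.

Lemma matching_card2 M e : matching M -> e \in M -> #|e| = 2.
Proof. by case/andP=> /forall_inP M2 _ /M2/eqP. Qed.

Lemma sub_matching M N : N \subset M -> matching M -> matching N.
Proof.
move=> sNM /andP[/forall_inP M2 tM]; apply/andP; split.
  by apply/forall_inP => e /(subsetP sNM); apply: M2.
exact: trivIsetS tM.
Qed.

Lemma card_cover_matching M : matching M -> #|cover M| = #|M|.*2.
Proof.
move=> mM; have /eqP <- := matching_trivIset mM.
rewrite -muln2 -sum_nat_const; apply: eq_bigr => e; exact: matching_card2.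
Qed.

Lemma matching_partner M x :
  matching M -> x \in cover M -> exists2 y, x != y & [set x; y] \in M.
Proof.
move=> mM /bigcupP[e eM xe].
have /eqP/cards2P[a [b [ab def_e]]] := matching_card2 mM eM.
move: xe; rewrite def_e in eM *; case/set2P=> ->.
  by exists b.
by exists a; [rewrite eq_sym | rewrite setUC].
Qed.

Lemma matching_disjoint M e f x :
  matching M -> e \in M -> f \in M -> x \in e -> x \in f -> e = f.
Proof.
move=> /matching_trivIset/trivIsetP tM eM fM xe xf; apply/eqP; apply/negPn/negP.
by move=> /(tM _ _ eM fM)/pred0P/(_ x) /=; rewrite xe xf.
Qed.

Lemma matching_add M x y :
    matching M -> x != y -> x \notin cover M -> y \notin cover M ->
  matching ([set x; y] |: M) /\ #|[set x; y] |: M| = #|M|.+1.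
Proof.
move=> mM xy xM yM.
have disj : {in M, forall e : {set T}, [disjoint [set x; y] & e]}.
  move=> e eM; rewrite disjoints_subset subUset !sub1set !inE.
  apply/andP; split; [apply: contra xM | apply: contra yM] => ae;
    by apply/bigcupP; exists e.
have no0 : set0 \notin M.
  by apply/negP => /(matching_card2 mM); rewrite cards0.
have [tM' xyM] := trivIsetU1 disj (matching_trivIset mM) no0.
split; last by rewrite cardsU1 xyM.
apply/andP; split=> //; apply/forall_inP => e /setU1P[-> | eM].
  by rewrite cards2 xy.
by rewrite (matching_card2 mM eM).
Qed.

Lemma cover_add M e : cover (e |: M) = e :|: cover M.
Proof. by rewrite /cover bigcup_setU big_set1. Qed.

Lemma exists_otherD (A B : {set T}) u w v : #|A| = #|B| -> u != w ->
  u \in B :\: A -> w \in B :\: A -> exists2 x, x != v & x \in A :\: B.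
Proof.
move=> cAB uw uD wD; have card2 : 1 < #|B :\: A|.
  have <- : #|[set u; w]| = 2 by rewrite cards2 uw.
  by apply: subset_leq_card; rewrite subUset !sub1set uD.
have cD : #|A :\: B| = #|B :\: A|.
  by apply: (@addnI #|A :&: B|); rewrite cardsID cAB setIC cardsID.
rewrite -cD (cardsD1 v) in card2.
have : 0 < #|(A :\: B) :\ v| by case: (v \in _) card2 => //= /ltnW.
by case/card_gt0P=> x /setD1P[]; exists x.
Qed.

(** * Gallai's lemma and the Tutte-Berge theorem *)

Section MaximumMatchings.
Variables (E : {set {set T}}) (W : {set T}) (m : nat).

Definition matching_in M := [&& M \subset E, matching M & cover M \subset W].
Definition maximum_in M := matching_in M && (#|M| == m).
(** Gallai's relation: by bonded_trans it is an equivalence on W as soon as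
    every vertex of W is avoided by some maximum matching. *)
Definition bonded u v :=
  (u == v) || [forall M, maximum_in M ==> (u \in cover M) || (v \in cover M)].

Hypothesis le_m : forall M, matching_in M -> #|M| <= m.
Hypothesis avoidable :
  forall v, v \in W -> exists2 M, maximum_in M & v \notin cover M.

Lemma maximum_in_matching M : maximum_in M -> matching M.
Proof. by case/andP => /and3P[]. Qed.

Lemma bonded_refl u : bonded u u.
Proof. by rewrite /bonded eqxx. Qed.

Lemma bonded_sym u v : bonded u v = bonded v u.
Proof.
rewrite /bonded eq_sym; congr (_ || _); apply: eq_forallb => M.
by rewrite (orbC (u \in _)).
Qed.

Lemma bonded_cover u v M :
  bonded u v -> u != v -> maximum_in M -> u \notin cover M -> v \in cover M.
Proof.
move=> /orP[/eqP-> | /forallP/(_ M)/implyP buv]; first by rewrite eqxx.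
by move=> _ /buv/orP[-> | ->].
Qed.

(** A matching missing both ends of an edge could be enlarged by that edge. *)
Lemma edge_covered x y M : x \in W -> y \in W -> x != y -> [set x; y] \in E ->
  maximum_in M -> (x \in cover M) || (y \in cover M).
Proof.
move=> xW yW xy xyE /andP[/and3P[sME mM sMW] /eqP cM].
apply/negPn/negP; rewrite negb_or => /andP[xM yM].
have [mM' cM'] := matching_add mM xy xM yM.
suff /le_m : matching_in ([set x; y] |: M) by rewrite cM' cM ltnn.
by rewrite /matching_in mM' cover_add !subUset !sub1set xyE sME sMW xW yW.
Qed.

Lemma edge_bonded x y : x \in W -> y \in W -> x != y -> [set x; y] \in E ->
  bonded x y.
Proof.
move=> xW yW xy xyE; apply/orP; right; apply/forallP => M; apply/implyP.
exact: edge_covered.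
Qed.

Lemma maximum_in_exchange N x y z : maximum_in N -> x \in W -> x != y ->
    x \notin cover N -> [set x; y] \in E -> [set y; z] \in N ->
  maximum_in ([set x; y] |: (N :\ [set y; z])).
Proof.
move=> maxN xW xy xN xyE yzN; have /andP[/and3P[sNE mN sNW] /eqP cN] := maxN.
have sDN := subD1set N [set y; z].
have cD : cover (N :\ [set y; z]) = cover N :\: [set y; z].
  exact: coverD1 (matching_trivIset mN) yzN.
have sN'N : cover (N :\ [set y; z]) \subset cover N by rewrite cD subsetDl.
have yN : y \in cover N by apply/bigcupP; exists [set y; z]; rewrite ?set21.
have y'N : y \notin cover (N :\ [set y; z]).
  by rewrite cD !inE eqxx.
have [mN' cN'] := matching_add (sub_matching sDN mN) xy
                    (contra (subsetP sN'N x) xN) y'N.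
rewrite /maximum_in /matching_in mN' cN' cover_add !subUset !sub1set xyE xW.
rewrite (subsetP sNW _ yN) (subset_trans sN'N) // (subset_trans sDN) //=.
by rewrite -cN (cardsD1 [set y; z] N) yzN.
Qed.

(** Gallai's lemma.  Suppose that the maximum matching M misses u and w.  Among
    the maximum matchings N missing v, choose one with the most edges in common
    with M.  Since u and w are covered by N and not by M, counting gives a
    vertex x other than v that is covered by M only.  If M contains xy and N
    contains yz, then replacing yz by xy in N brings it closer to M. *)
Lemma bonded_trans u v w : v \in W -> bonded u v -> bonded v w -> bonded u w.
Proof.
move=> vW buv bvw.
have [-> | uv] := eqVneq u v; first by [].
have [<- | vw] := eqVneq v w; first by [].
have [-> | uw] := eqVneq u w; first exact: bonded_refl.
apply/orP; right; apply/forallP => M; apply/implyP => maxM.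
apply/negPn/negP; rewrite negb_or => /andP[uM wM].
have [N0 maxN0 vN0] := avoidable vW.
pose P N := maximum_in N && (v \notin cover N).
have P0 : P N0 by rewrite /P maxN0.
have [N /andP[maxN vN] closest] := arg_maxnP (fun N => #|N :&: M|) P0.
have uN : u \in cover N.
  by apply: (bonded_cover _ _ maxN vN); rewrite 1?bonded_sym 1?eq_sym.
have wN : w \in cover N by apply: (bonded_cover _ _ maxN vN).
have mM := maximum_in_matching maxM; have mN := maximum_in_matching maxN.
have cMN : #|cover M| = #|cover N|.
  rewrite !card_cover_matching //.
  by case/andP: maxM => _ /eqP->; case/andP: maxN => _ /eqP->.
have [x /and3P[xv xN xM]] :
    exists x, [&& x != v, x \notin cover N & x \in cover M].
  have [] := @exists_otherD (cover M) (cover N) u w v cMN uw.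
  - by rewrite inE uM.
  - by rewrite inE wM.
  by move=> x xv /setDP[xM xN]; exists x; rewrite xv xN.
have [y xy xyM] := matching_partner mM xM.
have /andP[/and3P[sME _ sMW] _] := maxM.
have yM : y \in cover M by apply/bigcupP; exists [set x; y]; rewrite ?set22.
have xW := subsetP sMW _ xM; have yW := subsetP sMW _ yM.
have xyE := subsetP sME _ xyM.
have yN : y \in cover N.
  by have := edge_covered xW yW xy xyE maxN; rewrite (negPf xN).
have [z yz yzN] := matching_partner mN yN.
pose N' := [set x; y] |: (N :\ [set y; z]).
have vN' : v \notin cover N'.
  rewrite cover_add !inE !negb_or eq_sym xv.
  have -> /= : v != y by apply: contraNneq vN => ->.
  apply: contra vN => /bigcupP[e /setD1P[_ eN] ve].
  by apply/bigcupP; exists e.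
have yzM : [set y; z] \notin M.
  apply: contra xN => yzM.
  have exy : [set x; y] = [set y; z].
    by apply: (matching_disjoint (x := y) mM); rewrite ?set21 ?set22.
  by apply/bigcupP; exists [set y; z] => //; rewrite -exy set21.
have xyN : [set x; y] \notin N.
  by apply: contra xN => ?; apply/bigcupP; exists [set x; y]; rewrite ?set21.
have maxN' := maximum_in_exchange maxN xW xy xN xyE yzN.
have := closest N'; rewrite /P vN' andbT => /(_ maxN').
suff sub : [set x; y] |: (N :&: M) \subset N' :&: M.
  by move/(leq_trans (subset_leq_card sub)); rewrite cardsU1 inE (negPf xyN) ltnn.
apply/subsetP => e /setU1P[-> | /setIP[eN eM]]; rewrite !inE.
  by rewrite eqxx.
rewrite eN eM !andbT; apply/orP; right.
by apply: contraNneq yzM => <-.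
Qed.

(** The label of a vertex is its class for bonded: edges stay inside classes,
    and a maximum matching misses at most one vertex of each class. *)
Lemma gallai_labelling : exists c : T -> {set T},
  {in W &, forall x y, x != y -> [set x; y] \in E -> c x = c y} /\
  #|W| <= #|c @: W| + m.*2.
Proof.
exists (fun x => [set y in W | bonded x y]); split.
  move=> x y xW yW xy xyE; have bxy := edge_bonded xW yW xy xyE.
  apply/setP => z; rewrite !inE; case: (z \in W) => //=.
  by apply/idP/idP; apply: bonded_trans; rewrite // bonded_sym.
have [-> | [v vW]] := set_0Vmem W; first by rewrite cards0.
have [M maxM _] := avoidable vW; have /andP[/and3P[_ mM sMW] /eqP cM] := maxM.
rewrite -cM -card_cover_matching // -(cardsID (cover M) W) addnC.
rewrite (setIidPr sMW) leq_add2r.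
rewrite -(card_in_imset (f := fun x => [set y in W | bonded x y])); last first.
  move=> x y /setDP[xW xM] /setDP[yW yM] /setP/(_ y).
  rewrite !inE yW bonded_refl /= => bxy; apply/eqP; apply/negPn/negP => xy.
  by rewrite (bonded_cover bxy) in yM.
by apply/subset_leq_card/imsetS/subsetDl.
Qed.

End MaximumMatchings.

(** If every maximum matching covers v, then deleting v lowers the bound m by
    one, and v can be put in S; otherwise Gallai's lemma applies with S empty. *)
Lemma tutte_berge E W m : (forall M, matching_in E W M -> #|M| <= m) ->
  exists S (c : T -> {set T}),
    {in W :\: S &, forall x y, x != y -> [set x; y] \in E -> c x = c y} /\
    #|W| + #|S| <= #|c @: (W :\: S)| + m.*2.
Proof.
have [k] := ubnP #|W|; elim: k W m => // k IHk W m /ltnSE leWk le_m.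
have [/forall_inP noess | /forall_inPn[v vW /existsPn ess]] := boolP
    [forall v in W, exists M, maximum_in E W m M && (v \notin cover M)].
  have [|c] := @gallai_labelling E W m le_m.
    by move=> v /noess/existsP[M /andP[]]; exists M.
  by exists set0, c; rewrite setD0 cards0 addn0.
have small M : matching_in E (W :\ v) M -> #|M| < m.
  case/and3P=> sME mM sMW.
  have mWM : matching_in E W M.
    by rewrite /matching_in sME mM (subset_trans sMW) ?subD1set.
  rewrite ltn_neqAle le_m // andbT; apply: contra (ess M) => cM.
  rewrite /maximum_in mWM cM /=.
  by apply/negP => /(subsetP sMW); rewrite !inE eqxx.
have m_gt0 : 0 < m.
  suff /small : matching_in E (W :\ v) set0 by rewrite cards0.
  rewrite /matching_in sub0set /cover big_set0 sub0set andbT /=.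
  by apply/andP; split; [apply/forall_inP => e; rewrite inE
                        | apply/trivIsetP => e f; rewrite inE].
have cW := cardsD1 v W; rewrite vW in cW.
have [| M /small | S [c [cE cS]]] := IHk (W :\ v) m.-1; try lia.
exists (v |: S), c; have -> : W :\: (v |: S) = (W :\ v) :\: S by rewrite setDDl.
split=> //; have := cardsU1 v S; have := leq_b1 (v \notin S); lia.
Qed.

End Matchings.

(** * Counting vertices with barriers *)

(** In the order of increasing keys h, each weight exceeds the sum of the previous
    ones by r or more, so each partial sum is at least r plus twice the previous
    one. *)
Lemma doubling_sum (I : finType) (h a : I -> nat) r :
    (forall j, r + \sum_(i | (i != j) && (h i <= h j)) a i <= a j) ->
  (2 ^ #|I| - 1) * r <= \sum_i a i.
Proof.
move=> step; rewrite -sum1_card.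
suff main (J : {set I}) : (2 ^ #|J| - 1) * r <= \sum_(i in J) a i.
  have := main [set: I]; rewrite cardsT sum1_card.
  by under eq_bigl do rewrite inE.
have [k] := ubnP #|J|; elim: k J => // k IHk J /ltnSE leJk.
have [-> | [j0 j0J]] := set_0Vmem J; first by rewrite cards0 mul0n.
(* An index with the largest key: the bound on its weight sees all of J. *)
have [j jJ' jmax] := arg_maxnP h j0J; have jJ : j \in J := jJ'.
have cJ := cardsD1 j J; rewrite jJ in cJ.
have stepJ : r + \sum_(i in J :\ j) a i <= a j.
  apply: leq_trans (step j); rewrite leq_add2l.
  rewrite [leqRHS](bigID (mem (J :\ j))) /=; apply: leq_trans (leq_addr _ _).
  apply/eq_leq/eq_bigl => i; rewrite !inE.
  case: (i != j) => //=; have [/jmax hij | _] := boolP (i \in J); last by rewrite andbF.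
  by rewrite andbT; symmetry; apply: hij.
have {}IHk : (2 ^ #|J :\ j| - 1) * r <= \sum_(i in J :\ j) a i.
  by apply: IHk; lia.
rewrite (big_setD1 j jJ) /= cJ add1n expnS.
move: IHk stepJ.
move: (\sum_(i in _) _) (2 ^ _) (expn_gt0 2 #|J :\ j|) => s p /=; nia.
Qed.

(** The pair (S i, c i) is the barrier certifying that color i cannot be avoided;
    no_clash says that an edge cannot get both colors i and j. *)
Section Barriers.
Variables (T I L : finType) (q : nat) (S : I -> {set T}) (c : I -> T -> L).

Hypothesis many_labels : forall i, #|S i| + q + 2 <= #|c i @: (~: S i)|.
Hypothesis no_clash : forall i j x y, i != j ->
  x \notin S i -> y \notin S i -> x \notin S j -> y \notin S j ->
  c i x = c i y \/ c j x = c j y.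

(** If c i separates two vertices outside S i and S j, then c j is constant
    outside both sets, since any third vertex is separated by c i from one of
    these two.  Hence S i meets all label classes of c j but one, and is larger
    than S j. *)
Lemma constant_outside_larger i j x y : i != j -> #|S i| <= #|S j| ->
    x \notin S i -> y \notin S i -> x \notin S j -> y \notin S j ->
  c i x = c i y.
Proof.
move=> ij le_ij xi yi xj yj; apply/eqP/negPn/negP => ne_xy.
have const z : z \notin S i -> z \notin S j -> c j z = c j x.
  move=> zi zj; have [zx | //] := no_clash ij zi xi zj xj.
  have [xy | ->] := no_clash ij xi yi xj yj; first by rewrite xy eqxx in ne_xy.
  have [zy | //] := no_clash ij zi yi zj yj.
  by rewrite -zx zy eqxx in ne_xy.
have : (c j @: (~: S j)) \subset c j x |: (c j @: S i).
  apply/subsetP => _ /imsetP[z zj ->]; rewrite inE in zj.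
  have [zi | zi] := boolP (z \in S i); first by apply/setU1P; right; apply: imset_f.
  by apply/setU1P; left; apply: const.
move/subset_leq_card; rewrite cardsU1.
have := leq_b1 (c j x \notin c j @: S i); have := leq_imset_card (c j) (S i).
have := many_labels j; lia.
Qed.

(** Suppose the label of i seen outside S j differs from the one seen outside
    S l.  Then S j contains the whole class Y of y, together with one vertex at
    least of each remaining class but that of x.  As the complement of S l lies
    in the union of Y and S i, this makes S j larger than S l. *)
Lemma same_exceptional_label i j l x y : j != i -> l != i ->
    #|S i| <= #|S j| -> #|S j| <= #|S l| ->
    x \notin S i -> x \notin S j -> y \notin S i -> y \notin S l ->
  c i x = c i y.
Proof.
move=> ji li le_ij le_jl xi xj yi yl; apply/eqP/negPn/negP => ne_xy.
have ij : i != j by rewrite eq_sym.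
have il : i != l by rewrite eq_sym.
have le_il := leq_trans le_ij le_jl.
pose Y := [set z in ~: S i | c i z == c i y].
pose Z := [set z in ~: S i | (c i z != c i x) && (c i z != c i y)].
have sYZ : Y :|: Z \subset S j.
  apply/subsetP => z zYZ; apply/negPn/negP => zj.
  have zi : z \notin S i by case/setUP: zYZ; rewrite !inE => /andP[].
  have zx := constant_outside_larger ij le_ij zi xi zj xj.
  by case/setUP: zYZ; rewrite !inE zx ?eqxx ?andbF // (negPf ne_xy) andbF.
have cYZ : #|Y :|: Z| = #|Y| + #|Z|.
  rewrite cardsU [Y :&: Z](_ : _ = set0) ?cards0 ?subn0 //.
  by apply/setP => z; rewrite !inE; case: (c i z == c i y); rewrite ?andbF.
have cZ : #|c i @: (~: S i)| <= #|Z| + 2.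
  have : (c i @: (~: S i)) \subset (c i @: Z) :|: [set c i x; c i y].
    apply/subsetP => _ /imsetP[z zi ->]; rewrite !inE.
    have [_ | zx] := eqVneq (c i z) (c i x); first by rewrite /= !orbT.
    have [_ | zy] := eqVneq (c i z) (c i y); first by rewrite /= !orbT.
    apply/orP; left; apply: imset_f; rewrite !inE zx zy !andbT.
    by rewrite inE in zi.
  move/subset_leq_card/leq_trans; apply; apply: leq_trans (leq_card_setU _ _) _.
  by rewrite cards2; apply: leq_add (leq_imset_card _ _) _; case: (_ != _).
have cY : #|c l @: (~: S l)| <= #|Y| + #|S i|.
  apply: leq_trans (leq_imset_card _ _) _.
  apply: leq_trans (leq_card_setU _ _); apply: subset_leq_card.
  apply/subsetP => z; rewrite !inE => zl; case: (boolP (z \in S i)) => zi.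
    by rewrite orbT.
  by rewrite (constant_outside_larger il le_il zi yi zl yl) eqxx.
have := subset_leq_card sYZ; have := many_labels i; have := many_labels l.
lia.
Qed.

(** These sets are disjoint and each S j contains those of the smaller barriers,
    which makes their sizes double. *)
Definition core i := ~: S i :&: \bigcap_(j | (j != i) && (#|S i| <= #|S j|)) S j.

(** Outside S i, the vertices not in the core share a single label, so all the
    other labels of c i occur in the core. *)
Lemma card_core i : #|S i| + q + 1 <= #|core i|.
Proof.
have notin_core x : x \notin S i -> x \notin core i ->
    exists j, [/\ j != i, #|S i| <= #|S j| & x \notin S j].
  rewrite !inE => -> /=; move/bigcapP => nx.
  have [j | all_in] := pickP (fun j => [&& j != i, #|S i| <= #|S j| & x \notin S j]).
    by case/and3P; exists j.
  by case: nx => j /andP[ji le_ij]; have := all_in j; rewrite ji le_ij => /negbFE.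
have const x y : x \in ~: S i :\: core i -> y \in ~: S i :\: core i -> c i x = c i y.
  case/setDP; rewrite inE => xi /(notin_core _ xi)[j [ji le_ij xj]].
  case/setDP; rewrite inE => yi /(notin_core _ yi)[l [li le_il yl]].
  have [le_jl | /ltnW le_lj] := leqP #|S j| #|S l|.
    exact: (@same_exceptional_label i j l).
  by symmetry; apply: (@same_exceptional_label i l j).
have cD : #|c i @: (~: S i :\: core i)| <= 1.
  apply/card_le1_eqP => _ _ /imsetP[x xD ->] /imsetP[y yD ->].
  exact: const.
have : (c i @: (~: S i)) \subset (c i @: core i) :|: (c i @: (~: S i :\: core i)).
  rewrite -imsetU; apply: imsetS; apply/subsetP => x xi.
  by rewrite !in_setU in_setD xi andbT orbN.
move/subset_leq_card/leq_trans/(_ (leq_card_setU _ _)).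
have := leq_imset_card (c i) (core i); have := many_labels i; lia.
Qed.

Lemma core_sub i j : i != j -> #|S i| <= #|S j| -> core i \subset S j.
Proof.
move=> ij le_ij; apply: subset_trans (subsetIr _ _) _.
by apply: bigcap_inf; rewrite eq_sym ij.
Qed.

Lemma core_disjoint i j : i != j -> [disjoint core i & core j].
Proof.
wlog le_ij : i j / #|S i| <= #|S j| => [hw | ij].
  have [le_ij | /ltnW le_ji] := leqP #|S i| #|S j|; first exact: hw.
  by rewrite eq_sym disjoint_sym; apply: hw.
rewrite disjoints_subset; apply: subset_trans (core_sub ij le_ij) _.
by rewrite subsetC subsetIl.
Qed.

Lemma card_bigcup_core (P : pred I) :
  #|\bigcup_(i | P i) core i| = \sum_(i | P i) #|core i|.
Proof.
pose F i := if P i then core i else set0.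
have disjF i j : i != j -> [disjoint F i & F j].
  rewrite /F => ij; case: (P i); last by rewrite -setI_eq0 set0I.
  by case: (P j); [apply: core_disjoint | rewrite -setI_eq0 setI0].
rewrite big_mkcond -sum1_card (partition_disjoint_bigcup _ _ disjF) /=.
rewrite [RHS]big_mkcond; apply: eq_bigr => i _; rewrite sum1_card /F.
by case: (P i); rewrite ?cards0.
Qed.

Lemma barriers_bound : (2 ^ #|I| - 1) * q.+1 <= #|T|.
Proof.
apply: leq_trans (max_card (mem (\bigcup_i core i))).
rewrite (card_bigcup_core xpredT).
apply: (@doubling_sum I (fun i => #|S i|)) => j.
apply: leq_trans (card_core j); rewrite -card_bigcup_core.
have : \bigcup_(i | (i != j) && (#|S i| <= #|S j|)) core i \subset S j.
  by apply/bigcupsP => i /andP[ij le_ij]; apply: core_sub.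
by move/subset_leq_card; lia.
Qed.

End Barriers.

(** * The block coloring *)

(** The t such that i lies between (2 ^ t - 1) * q.+1 and
    (2 ^ t.+1 - 1) * q.+1; block q n is then also the optimal number of colors,
    by leq_block. *)
Definition block q i := trunc_log 2 (i %/ q.+1).+1.

Lemma leq_block q t i : (t <= block q i) = ((2 ^ t - 1) * q.+1 <= i).
Proof.
rewrite -leq_divRL // /block leq_subLR add1n.
apply/idP/idP => [le_t | ]; last exact: trunc_log_max.
apply: leq_trans (trunc_logP (p := 2) isT (ltn0Sn _)); exact: leq_pexp2l.
Qed.

(** The edge takes the block of its least vertex; the minimum with k.-1 merges
    the incomplete block that may follow the first k blocks into the last one. *)
Definition block_color q k n (e : {set 'I_n}) : nat :=
  if [pick i in e | [forall j in e, i <= j]] is Some i then minn k.-1 (block q i)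
  else 0.

Lemma block_colorE q k n (e : {set 'I_n}) (i : 'I_n) :
  i \in e -> (forall j : 'I_n, j \in e -> i <= j) ->
  block_color q k e = minn k.-1 (block q i).
Proof.
move=> ie imin; rewrite /block_color; case: pickP => [i' /andP[i'e /forall_inP i'min]|].
  have -> // : i' = i by apply/val_inj/anti_leq; rewrite i'min ?imin.
by move/(_ i); rewrite ie => /negP[]; apply/forall_inP.
Qed.

Lemma block_color_pair q k n (i j : 'I_n) : i <= j ->
  block_color q k [set i; j] = minn k.-1 (block q i).
Proof. by move=> ij; apply: block_colorE; rewrite ?set21 // => a /set2P[]->. Qed.

Lemma leq_block_mono q i j : i <= j -> block q i <= block q j.
Proof. by move=> ij; rewrite leq_block (leq_trans _ ij) // -leq_block. Qed.

Lemma block_color_simply_ordered q k n : simply_ordered (@block_color q k n).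
Proof.
exists 1%g; split=> [i j m ij jm | i j m a ij jm]; rewrite !permE.
  by rewrite !block_color_pair // ltnW // (ltn_trans ij).
rewrite !block_color_pair 1?ltnW // 1?(ltn_trans ij) // => ca cb t it tj.
rewrite permE block_color_pair 1?ltnW ?(leq_ltn_trans tj) //.
have := leq_block_mono q it; have := leq_block_mono q tj; lia.
Qed.

Lemma card_ord_lt n b : b <= n -> #|[set i : 'I_n | i < b]| = b.
Proof.
move=> le_bn; have inj_w : injective (widen_ord le_bn).
  by move=> i j /(congr1 val) /= ij; apply: val_inj.
rewrite -[RHS]card_ord -(card_imset _ inj_w).
congr #|pred_of_set _|; apply/setP => i; rewrite inE.
apply/idP/imsetP => [ib | [j _ ->]]; last exact: (valP j).
by exists (Ordinal ib) => //; apply: val_inj.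
Qed.

Definition partner n (M : {set {set 'I_n}}) x : 'I_n :=
  odflt x [pick y | (x != y) && ([set x; y] \in M)].

Lemma partnerP n (M : {set {set 'I_n}}) x : matching M -> x \in cover M ->
  x != partner M x /\ [set x; partner M x] \in M.
Proof.
move=> mM xM; rewrite /partner; case: pickP => [y /andP[] // | no_y].
by have [y xy xyM] := matching_partner mM xM; have := no_y y; rewrite xy xyM.
Qed.

Lemma partner_inj n (M : {set {set 'I_n}}) : matching M ->
  {in cover M &, injective (partner M)}.
Proof.
move=> mM x x' xM x'M eq_y.
have [xy xyM] := partnerP mM xM; have [_ x'yM] := partnerP mM x'M.
have /setP/(_ x) : [set x; partner M x] = [set x'; partner M x'].
  by apply: (matching_disjoint (x := partner M x) mM); rewrite // ?eq_y set22.
by rewrite !inE eqxx -eq_y (negPf xy) !orbF => /esym/eqP.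
Qed.

Lemma block_start q t i : (2 ^ t - 1) * q.+1 <= i < (2 ^ t.+1 - 1) * q.+1 ->
  block q i = t.
Proof.
case/andP; rewrite -leq_block ltnNge -leq_block -ltnNge ltnS => ? ?.
exact/anti_leq/andP.
Qed.

(** A matching avoiding color t would send every covered vertex of block t to a
    partner below the block.  At most q vertices are uncovered, but the block
    has q.+1 vertices more than there are below it. *)
Lemma block_color_on_matching q k n (M : {set {set 'I_n}}) t :
    k <= block q n -> t < k -> M \in matchings_missing q n ->
  exists2 e, e \in M & block_color q k e = t.
Proof.
move=> le_kn lt_tk; rewrite inE => /and3P[_ mM /eqP cM].
have [/exists_inP[e eM /eqP et] | /exists_inPn no_t] :=
  boolP [exists e in M, block_color q k e == t]; first by exists e.
pose p s := (2 ^ s - 1) * q.+1.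
have pS : p t.+1 = p t + p t + q.+1.
  rewrite /p expnS; have := expn_gt0 2 t; move: (2 ^ t) => r /=; nia.
have le_pn : p t.+1 <= n by rewrite -leq_block (leq_trans lt_tk).
pose A s := [set i : 'I_n | i < p s].
have cA : #|A t| = p t by apply: card_ord_lt; lia.
have cA' : #|A t.+1| = p t.+1 by apply: card_ord_lt.
have color_t (i : 'I_n) : i \in A t.+1 :\: A t -> minn k.-1 (block q i) = t.
  by rewrite !inE -leqNgt => /block_start->; lia.
have partner_below : partner M @: ((A t.+1 :\: A t) :&: cover M) \subset A t.
  apply/subsetP => _ /imsetP[x /setIP[xB xM] ->].
  have [_ xyM] := partnerP mM xM; move: (partner M x) xyM => y xyM.
  have := no_t _ xyM; apply: contraR => yA; apply/eqP.
  have [le_xy | /ltnW le_yx] := leqP x y.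
    by rewrite block_color_pair // color_t.
  rewrite setUC block_color_pair // color_t // inE yA.
  by move: xB; rewrite !inE => /andP[_]; apply: leq_ltn_trans.
have := subset_leq_card partner_below; rewrite card_in_imset; last first.
  by move=> x y /setIP[_ xM] /setIP[_ yM]; apply: partner_inj.
have := cardsID (cover M) (A t.+1 :\: A t).
have : #|(A t.+1 :\: A t) :\: cover M| <= #|~: cover M|.
  by apply: subset_leq_card; rewrite setDE subsetIr.
have := cardsC (cover M); rewrite card_ord cM.
have := cardsID (A t) (A t.+1); have := subset_leq_card (subsetIr (A t.+1) (A t)).
rewrite cA cA'; move: #|_| #|_| #|_| #|_| #|_| => *; lia.
Qed.

Lemma mem_colors (T : finType) (phi : {set T} -> nat) (G : {set {set T}}) a :
  reflect (exists2 e, e \in G & phi e = a) (a \in colors phi G).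
Proof.
rewrite /colors mem_undup.
by apply: (iffP imageP) => -[e eG ea]; exists e.
Qed.

Lemma exists_subset_card (T : finType) (A : {set T}) h :
  h <= #|A| -> exists2 B : {set T}, B \subset A & #|B| = h.
Proof.
move=> le_hA; exists [set x in take h (enum A)].
  by apply/subsetP => x; rewrite inE => /mem_take; rewrite mem_enum.
rewrite cardsE; have /card_uniqP -> := take_uniq h (enum_uniq A).
by rewrite size_takel // -cardE.
Qed.

(** * Optimality *)

(** A matching with (n - q) / 2 edges or more, none of color a, would contain one
    spanning exactly n - q vertices; so the Tutte-Berge theorem applies to the
    edges of the other colors with m = (n - q) / 2 - 1. *)
Lemma polychromatic_barrier q n phi a : 0 < n - q -> ~~ odd (n - q) ->
    polychromatic (complete_graph n) (matchings_missing q n) phi ->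
    a \in colors phi (complete_graph n) ->
  exists (Sc : {set 'I_n} * ('I_n -> {set 'I_n})),
    {in ~: Sc.1 &, forall x y, x != y -> phi [set x; y] != a -> Sc.2 x = Sc.2 y} /\
    #|Sc.1| + q + 2 <= #|Sc.2 @: (~: Sc.1)|.
Proof.
move=> nq_gt0 nq_even poly_phi a_col.
pose E := [set e in complete_graph n | phi e != a].
have [M | S [c [cE cS]]] := @tutte_berge _ E setT (n - q)./2.-1.
  case/and3P=> sME mM _; rewrite leqNgt; apply/negP => ltM.
  have [N sNM cN] := @exists_subset_card _ M (n - q)./2 ltac:(lia).
  have mN := sub_matching sNM mM; have sNE := subset_trans sNM sME.
  have /poly_phi/(_ a a_col)/mem_colors[e eN ea] : N \in matchings_missing q n.
    rewrite inE mN card_cover_matching // cN even_halfK // eqxx !andbT.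
    by apply: (subset_trans sNE); apply/subsetP => e /setIdP[].
  by have := subsetP sNE e eN; rewrite inE ea eqxx andbF.
exists (S, c); rewrite -setTD; split=> [x y xS yS xy xya | ] /=.
  by apply: cE => //; rewrite !inE cards2 xy xya.
move: cS; rewrite cardsT card_ord; move: #|_| #|_| => s l.
have := even_halfK nq_even; lia.
Qed.

Lemma num_colors_bound q n phi : 0 < n - q -> ~~ odd (n - q) ->
    polychromatic (complete_graph n) (matchings_missing q n) phi ->
  num_colors phi (complete_graph n) <= block q n.
Proof.
move=> nq_gt0 nq_even poly_phi; set k := num_colors _ _.
pose a (i : 'I_k) := nth 0 (colors phi (complete_graph n)) i.
have a_inj i j : a i = a j -> i = j.
  by move/eqP; rewrite nth_uniq ?undup_uniq // => /eqP/val_inj.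
have a_col i : a i \in colors phi (complete_graph n) by apply: mem_nth.
have [Sc ScP] := fin_all_exists
  (fun i => polychromatic_barrier nq_gt0 nq_even poly_phi (a_col i)).
rewrite leq_block -[k]card_ord -[leqRHS]card_ord.
apply: (@barriers_bound 'I_n 'I_k _ q (fun i => (Sc i).1) (fun i => (Sc i).2)).
  by move=> i; case: (ScP i).
move=> i j x y ij xi yi xj yj; have [-> | xy] := eqVneq x y; first by left.
have [ci _] := ScP i; have [cj _] := ScP j.
have [xyi | xyi] := eqVneq (phi [set x; y]) (a i); [right | left].
  apply: cj; rewrite ?inE // xyi; apply: contra ij => /eqP/a_inj->; exact: eqxx.
by apply: ci; rewrite ?inE.
Qed.

(** The first two vertices of block t span an edge of color t. *)
Lemma block_color_surj q n t : 1 < n -> t < block q n ->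
  t \in colors (@block_color q (block q n) n) (complete_graph n).
Proof.
move=> n_gt1 lt_t; have := lt_t; rewrite leq_block expnS => le_pn.
set p := (2 ^ t - 1) * q.+1.
have ltpn : p.+1 < n.
  by move: le_pn; rewrite /p; have := expn_gt0 2 t; move: (2 ^ t) => r /=; nia.
apply/mem_colors; exists [set Ordinal (ltnW ltpn); Ordinal ltpn].
  by rewrite inE cards2 -val_eqE /= neq_ltn ltnSn.
rewrite block_color_pair //= (@block_start q t p); first lia.
by rewrite leqnn /= expnS /p; have := expn_gt0 2 t; move: (2 ^ t) => r /=; nia.
Qed.

Theorem theorem2p1 (q n : nat) (Hpos : 0 < n - q) (Heven : ~~ odd (n - q)) :
  exists phi : {set 'I_n} -> nat,
    optimal (complete_graph n) (matchings_missing q n) phi /\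
    simply_ordered phi.
Proof.
have n_gt1 : 1 < n by lia.
have k_gt0 : 0 < block q n by rewrite leq_block; lia.
pose phi := @block_color q (block q n) n.
have poly_phi : polychromatic (complete_graph n) (matchings_missing q n) phi.
  move=> M M_in a /mem_colors[e _ ea]; apply/mem_colors.
  apply: block_color_on_matching M_in => //.
  rewrite -ea /phi /block_color; case: pickP => // i _; lia.
exists phi; split; last exact: block_color_simply_ordered.
split=> //; split=> [|psi poly_psi]; first by exists phi.
apply: leq_trans (num_colors_bound Hpos Heven poly_psi) _.
rewrite -[leqLHS](size_iota 0) uniq_leq_size ?iota_uniq // => t.
by rewrite mem_iota => /block_color_surj; apply.
Qed.
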